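(* Let $n\ge 2$ and consider the absent-minded passengers process with one absent-minded passenger: there are $n$ seats labelled $1,\dots,n$ and $n$ passengers labelled $1,\dots,n$, where the correct seat of passenger $i$ is seat $i$. Passengers board in the order $1,\dots,n$; passenger $1$ chooses a seat uniformly at random among all $n$ seats; each passenger $i\ge 2$ takes seat $i$ if it is empty and otherwise chooses uniformly at random among the currently empty seats. Let $X_n$ be the number of passengers who end up in a seat other than their own. For $r\ge1$ write $H_r=\sum_{i=1}^{n-1} i^{-r}$, and let $m_s(X_n)=E[(X_n-E[X_n])^s]$. Then $$E[X_n]=H_1,\qquad \mathrm{Var}[X_n]=\frac{nH_1-nH_2+2H_1}{n},$$ $$m_3(X_n)=\frac{nH_1-3nH_2+2nH_3-3H_1^2+6H_1-3H_2}{n},$$ $$m_4(X_n)=\frac{3nH_1^2-6nH_1H_2+3nH_2^2+4H_1^3+nH_1-7nH_2+12nH_3-6nH_4-6H_1^2+14H_1-18H_2+8H_3}{n},$$ $$m_5(X_n)=\frac{1}{n}\Big(-5H_1^4+10nH_1^2-40nH_1H_2+20nH_1H_3+30nH_2^2-20nH_2H_3+10H_1^3+nH_1-15nH_2+50nH_3-60nH_4+24nH_5$$ $$+5H_1^2-30H_1H_2+15H_2^2+30H_1-75H_2+80H_3-30H_4\Big),$$ $$m_6(X_n)=\frac{1}{n}\Big(6H_1^5+15nH_1^3-45nH_1^2H_2+45nH_1H_2^2-15nH_2^3-15H_1^4+25nH_1^2-180nH_1H_2+220nH_1H_3-90nH_1H_4$$ $$+195nH_2^2-300nH_2H_3+90nH_2H_4+40nH_3^2+20H_1^3+nH_1-31nH_2+180nH_3-390nH_4+360nH_5-120nH_6$$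 $$+90H_1^2-330H_1H_2+120H_1H_3+225H_2^2-120H_2H_3+62H_1-270H_2+520H_3-450H_4+144H_5\Big).$$
   Context: The quantities $H_r$ depend on $n$ (the upper summation limit is $n-1$, not $n$). *)

(* Defs.v *)
From HB Require Import structures.
From mathcomp Require Import all_boot all_order all_algebra.
From mathcomp Require Import all_classical all_reals all_analysis.

Set Implicit Arguments.
Unset Strict Implicit.
Unset Printing Implicit Defensive.

Import Order.TTheory GRing.Theory Num.Theory.
Import numFieldNormedType.Exports.

Local Open Scope classical_set_scope.
Local Open Scope ring_scope.

(* Seats and passengers are numbered from 0: the element i of 'I_n stands for
   the passenger (and the seat) of label i + 1, so the absent-minded passenger,
   who boards first, is the ordinal of value 0. *)

Definition empty_seats (n : nat) (h : 'I_n -> 'I_n) (i : 'I_n) : {set 'I_n} :=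
  [set k : 'I_n | [forall j : 'I_n, (j < i)%N ==> (h j != k)]]%SET.

(* Probability that passenger i sits in seat k, given that each earlier
   passenger j sits in seat h j (the values h j for j >= i are not used). *)
Definition seat_prob (R : realType) (n : nat) (h : 'I_n -> 'I_n)
    (i k : 'I_n) : R :=
  if (i == 0 :> nat)%N then n%:R^-1
  else if i \in empty_seats h i then (k == i)%:R
  else if k \in empty_seats h i then #|empty_seats h i|%:R^-1
  else 0.

(* S i w is the seat taken by passenger i in the outcome w. The second clause
   is the chain rule: conditionally on the seats of all the earlier passengers,
   the seat of passenger i has law seat_prob h i. It is written as a product
   because the conditioning event may be null; for i of value 0 that event is
   the whole space. *)
Definition absent_minded_process (d : measure_display) (T : measurableType d)
    (R : realType) (P : probability T R) (n : nat)
    (S : 'I_n -> T -> 'I_n) : Prop :=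
  (forall i k : 'I_n, measurable [set w | S i w = k]) /\
  (forall (h : 'I_n -> 'I_n) (i : 'I_n),
     P [set w | forall j : 'I_n, (j <= i)%N -> S j w = h j] =
     (P [set w | forall j : 'I_n, (j < i)%N -> S j w = h j] *
      (seat_prob R h i (h i))%:E)%E).

Definition misplaced (R : realType) (T : Type) (n : nat)
    (S : 'I_n -> T -> 'I_n) (w : T) : R :=
  #|[set i : 'I_n | S i w != i]%SET|%:R.

Definition central_moment (d : measure_display) (T : measurableType d)
    (R : realType) (P : probability T R) (X : T -> R) (s : nat) : \bar R :=
  'E_P[(fun w => (X w - fine 'E_P[X]%E) ^+ s)%R]%E.

(* The sum stops at i = n - 1. *)
Definition harmonic_sum (R : realType) (n r : nat) : R :=
  \sum_(1 <= i < n) i%:R ^- r.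

(* Main.v *)
(* When passenger i >= 1 boards, the taken seats are those of 1, ..., i - 1
   and one extra seat, which is uniform on the n - i + 1 remaining seats and
   independent of the number C of passengers among 1, ..., i - 1 that are
   misplaced. Hence passenger i is misplaced independently of the past with
   probability 1 / (n - i + 1), and C + 1 is finally distributed as a sum
   B_1 + ... + B_n of independent Bernoulli variables of parameters 1/j. The
   number of misplaced passengers is C + 1 unless C = 0, in which case it is 0,
   and C = 0 has probability 1/n. Setting B_n apart, the mean of
   B_1 + ... + B_(n-1) is H_1 and its cumulants are linear in the H_r. *)

Require Import Defs.
From HB Require Import structures.
From mathcomp Require Import all_boot all_order all_algebra.
From mathcomp Require Import all_classical all_reals all_analysis.
From mathcomp Require Import ring.

Set Implicit Arguments.
Unset Strict Implicit.
Unset Printing Implicit Defensive.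

Import Order.TTheory GRing.Theory Num.Theory.
Import numFieldNormedType.Exports.

Local Open Scope classical_set_scope.
Local Open Scope ring_scope.

(** * Sums of independent Bernoulli variables and their moments *)

Definition bernoulli_step (R : realType) (p : R) (f : nat -> R) (c : nat) : R :=
  (1 - p) * f c + p * f c.+1.

(* The mean of f (c + B_1 + ... + B_m), where the B_j are independent Bernoulli
   variables of parameters 1/j. *)
Fixpoint bernoulli_mean (R : realType) (m : nat) (f : nat -> R) : nat -> R :=
  if m is m'.+1 then bernoulli_step m'.+1%:R^-1 (bernoulli_mean m' f) else f.

Arguments bernoulli_mean : simpl never.

Lemma bernoulli_meanS (R : realType) (m : nat) (f : nat -> R) :
  bernoulli_mean m.+1 f = bernoulli_step m.+1%:R^-1 (bernoulli_mean m f).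
Proof. by []. Qed.

(** As B_1 = 1 surely, the total is 1 only if c = 0 and B_2, ..., B_m all vanish; the product of the
    1 - 1/j telescopes to 1/m. *)
Lemma bernoulli_mean_atom1 (R : realType) (m c : nat) : (0 < m)%N ->
  bernoulli_mean m (fun c => (c == 1)%:R : R) c = (c == 0)%:R / m%:R.
Proof.
case: m => // m _; elim: m c => [|m IHm] c.
  by rewrite bernoulli_meanS /bernoulli_step invr1 subrr mul0r add0r mul1r mulr1.
rewrite bernoulli_meanS /bernoulli_step !IHm mul0r mulr0 addr0.
have m0 : m.+1%:R != 0 :> R by rewrite pnatr_eq0.
move: m0; rewrite -(natr1 m.+1); move: (m.+1%:R : R) (ltr0Sn R m) => x x0 xN0.
by field; rewrite xN0 gt_eqF// ltr_wpDr.
Qed.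

(* The r-th cumulant of B_1 + ... + B_m in terms of the power sums
   H r = sum_(j <= m) j^-r. *)
Definition bernoulli_cumulant (R : realType) (H : nat -> R) (r : nat) : R :=
  match r with
  | 1%N => H 1
  | 2%N => H 1 - H 2
  | 3%N => H 1 - 3 * H 2 + 2 * H 3
  | 4%N => H 1 - 7 * H 2 + 12 * H 3 - 6 * H 4
  | 5%N => H 1 - 15 * H 2 + 50 * H 3 - 60 * H 4 + 24 * H 5
  | 6%N => H 1 - 31 * H 2 + 180 * H 3 - 390 * H 4 + 360 * H 5 - 120 * H 6
  | _ => 0
  end.

(* The s-th moment, for s <= 6, of a variable of mean x whose cumulants of
   order r >= 2 are k r (complete Bell polynomials). *)
Definition moment_of_cumulants (R : realType) (x : R) (k : nat -> R)
    (s : nat) : R :=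
  match s with
  | 0%N => 1
  | 1%N => x
  | 2%N => x ^+ 2 + k 2
  | 3%N => x ^+ 3 + 3 * k 2 * x + k 3
  | 4%N => x ^+ 4 + 6 * k 2 * x ^+ 2 + 4 * k 3 * x + k 4 + 3 * k 2 ^+ 2
  | 5%N => x ^+ 5 + 10 * k 2 * x ^+ 3 + 10 * k 3 * x ^+ 2
         + 5 * (k 4 + 3 * k 2 ^+ 2) * x + k 5 + 10 * k 3 * k 2
  | 6%N => x ^+ 6 + 15 * k 2 * x ^+ 4 + 20 * k 3 * x ^+ 3
         + 15 * (k 4 + 3 * k 2 ^+ 2) * x ^+ 2
         + 6 * (k 5 + 10 * k 3 * k 2) * x
         + k 6 + 15 * k 4 * k 2 + 10 * k 3 ^+ 2 + 15 * k 2 ^+ 3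
  | _ => 0
  end.

Lemma harmonic_sum1 (R : realType) (r : nat) : harmonic_sum R 1 r = 0.
Proof. by rewrite /harmonic_sum big_geq. Qed.

Lemma harmonic_sumS (R : realType) (m r : nat) :
  harmonic_sum R m.+2 r = harmonic_sum R m.+1 r + m.+1%:R^-1 ^+ r.
Proof. by rewrite /harmonic_sum big_nat_recr //= exprVn. Qed.

(** Cumulants of independent variables add, and replacing each [H j] by p^j in [bernoulli_cumulant]
    gives those of a Bernoulli variable of parameter p. So adding one variable is, for each [s], a
    polynomial identity in p and the power sums. *)
Lemma bernoulli_mean_moment (R : realType) (a : R) (m s c : nat) : (s <= 6)%N ->
  bernoulli_mean m (fun c => (c%:R - a) ^+ s) c =
  moment_of_cumulants (c%:R + harmonic_sum R m.+1 1 - a)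
    (bernoulli_cumulant (harmonic_sum R m.+1)) s.
Proof.
move=> s6; elim: m c => [|m IHm] c.
  rewrite /bernoulli_mean.
  by do 7?[case: s s6 => [|s] s6 //=]; rewrite !harmonic_sum1; ring.
rewrite bernoulli_meanS /bernoulli_step !IHm {IHm} -[c.+1%:R]natr1.
by do 7?[case: s s6 => [|s] s6 //=]; rewrite ?harmonic_sumS;
  generalize (m.+1%:R^-1 : R) (harmonic_sum R m.+1) => p H; ring.
Qed.

(** * Combinatorics of admissible seatings *)

(** The bound [i] is a number rather than a passenger, so that it can be [n], when everyone is
    seated. *)
Definition taken (n : nat) (h : 'I_n -> 'I_n) (i : nat) (k : 'I_n) : bool :=
  [exists j : 'I_n, (j < i)%N && (h j == k)].

(* The absent-minded passenger 0 is not counted. *)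
Definition misplaced_before (n : nat) (h : 'I_n -> 'I_n) (i : nat) : nat :=
  \sum_(j < n | (0 < j < i)%N) (h j != j).

(* Seatings of positive probability satisfy this. *)
Definition admissible (n : nat) (h : 'I_n -> 'I_n) : Prop :=
  forall i : 'I_n, (0 < i)%N ->
    ~~ taken h i (h i) /\ (~~ taken h i i -> h i = i).

Lemma in_empty_seats (n : nat) (h : 'I_n -> 'I_n) (i k : 'I_n) :
  (k \in empty_seats h i) = ~~ taken h i k.
Proof.
rewrite inE negb_exists; apply: eq_forallb => j.
by rewrite negb_and implybE.
Qed.

Lemma taken_S (n : nat) (h : 'I_n -> 'I_n) (i k : 'I_n) :
  taken h i.+1 k = taken h i k || (h i == k).
Proof.
apply/existsP/orP => [[j]|[/existsP[j /andP[ji hj]]|hi]].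
- rewrite ltnS leq_eqVlt => /andP[/orP[/eqP/val_inj ->|ji] hj]; first by right.
  by left; apply/existsP; exists j; rewrite ji.
- by exists j; rewrite hj ltnS ltnW.
- by exists i; rewrite ltnS leqnn.
Qed.

Lemma misplaced_before_S (n : nat) (h : 'I_n -> 'I_n) (i : 'I_n) : (0 < i)%N ->
  misplaced_before h i.+1 = (misplaced_before h i + (h i != i))%N.
Proof.
move=> i0; rewrite /misplaced_before (bigD1 i) ?i0 ?ltnSn //= addnC.
congr (_ + _)%N; apply: eq_bigl => j.
by rewrite ltnS -andbA; congr (_ && _); rewrite ltn_neqAle andbC.
Qed.

Lemma seat_prob_admissible (R : realType) (n : nat) (h : 'I_n -> 'I_n) :
  (forall i, seat_prob R h i (h i) != 0) -> admissible h.
Proof.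
move=> h_neq0 i i0; move: (h_neq0 i); rewrite /seat_prob gtn_eqF //.
rewrite !in_empty_seats; case: ifPn => [i_free|i_taken].
  by case: (h i =P i) => [hi _|_]; [rewrite hi | rewrite eqxx].
by case: ifPn => [hi _|_]; rewrite ?eqxx//; split=> // /negP; rewrite i_taken.
Qed.

Lemma admissible_inj (n : nat) (h : 'I_n -> 'I_n) : admissible h -> injective h.
Proof.
move=> adm.
have lt_neq (i j : 'I_n) : (i < j)%N -> h i != h j.
  move=> ij; have [+ _] := adm j (leq_ltn_trans (leq0n _) ij).
  by apply: contra => hij; apply/existsP; exists i; rewrite ij.
move=> i j hij; apply/val_inj; case: (ltngtP i j) => // /lt_neq;
  by rewrite hij eqxx.
Qed.

Lemma card_empty_seats (n : nat) (h : 'I_n -> 'I_n) (i : 'I_n) :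
  admissible h -> #|empty_seats h i| = (n - i)%N.
Proof.
move=> adm; pose before : {set 'I_n} := [set j : 'I_n | (j < i)%N]%SET.
have -> : empty_seats h i = (~: (h @: before))%SET.
  apply/setP => k; rewrite in_empty_seats inE; congr (~~ _).
  apply/existsP/imsetP => [[j /andP[ji /eqP <-]]|[j ji ->]].
    by exists j => //; rewrite inE.
  by exists j; rewrite inE in ji; rewrite ji eqxx.
rewrite cardsCs finset.setCK card_ord card_imset; last exact: admissible_inj.
congr (_ - _)%N; rewrite cardsE -sum1_card -[RHS]card_ord -sum1_card.
by rewrite (big_ord_widen n (fun=> 1%N) (ltnW (ltn_ord i))).
Qed.

(* [(k == 0) || (i <= k)] says that k is none of the seats 1, ..., i - 1, which
   are all taken before passenger i boards. *)
Lemma admissible_extra_seat (n : nat) (h : 'I_n -> 'I_n) (i : nat) (k l : 'I_n) :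
  admissible h -> (0 < i <= n)%N ->
  (k == 0 :> nat) || (i <= k)%N -> (l == 0 :> nat) || (i <= l)%N ->
  taken h i k -> taken h i l -> k = l.
Proof.
move=> adm; elim: i k l => [//|[|i] IHi] k l /andP[_ i_n] k_out l_out.
  move=> /existsP[j /andP[j0 /eqP <-]] /existsP[j' /andP[j'0 /eqP <-]].
  move: j0 j'0; rewrite !ltnS !leqn0 => /eqP j0 /eqP j'0.
  by rewrite (_ : j = j') //; apply/val_inj; rewrite /= j0 j'0.
pose i' := Ordinal i_n; rewrite (taken_S h i') (taken_S h i').
have out (m : 'I_n) : (m == 0 :> nat) || (i.+2 <= m)%N ->
  (m == 0 :> nat) || (i.+1 <= m)%N by case/orP=> [->//|/ltnW ->]; rewrite orbT.
have i'_neq (m : 'I_n) : (m == 0 :> nat) || (i.+2 <= m)%N -> i' != m.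
  by rewrite -val_eqE /= => /orP[/eqP ->//|im]; rewrite ltn_eqF.
have i_le : (0 < i.+1 <= n)%N by rewrite (ltnW i_n).
(* If the seat of [i'] is taken, it is the only extra seat by induction, so [k] and [l] can only be
   the seat that [i'] now takes. Otherwise [i'] sits at home and the extra seat does not change. *)
have [i'_taken|i'_free] := boolP (taken h i' i').
  have not_taken (m : 'I_n) : (m == 0 :> nat) || (i.+2 <= m)%N ->
      taken h i.+1 m = false.
    move=> m_out; apply: contraNF (i'_neq m m_out) => m_taken; apply/eqP.
    by apply: IHi i_le _ (out m m_out) i'_taken m_taken; rewrite leqnn orbT.
  by rewrite /= !not_taken //= => /eqP <- /eqP <-.
have [_ /(_ i'_free) ->] := adm i' isT.
rewrite (negPf (i'_neq _ k_out)) (negPf (i'_neq _ l_out)) !orbF.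
by apply: IHi => //; exact: out.
Qed.

(** If seat [i] is free, passenger [i] takes it and nothing changes at [k]. If it is taken, it is
    the only extra seat, so [k] was free, [i] is misplaced, and [k] becomes taken exactly when [i]
    chooses it. *)
Lemma admissible_step (R : realType) (n : nat) (h : 'I_n -> 'I_n)
    (g : nat -> R) (i k : 'I_n) :
  admissible h -> (0 < i)%N -> (k == 0 :> nat) || (i < k)%N ->
  g (misplaced_before h i.+1) * (taken h i.+1 k)%:R =
  g (misplaced_before h i) * (taken h i k)%:R
  + g (misplaced_before h i).+1 * (taken h i i)%:R * (h i == k)%:R.
Proof.
move=> adm i0 k_out; rewrite misplaced_before_S // taken_S.
have [hi_free i_stay] := adm i i0.
have i_neq : i != k.
  rewrite -val_eqE /=.
  by case/orP: k_out => [/eqP ->|ik]; [rewrite gtn_eqF|rewrite ltn_eqF].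
have [i_taken|i_free] := boolP (taken h i i); last first.
  by rewrite i_stay // eqxx (negPf i_neq) addn0 orbF !mulr0 addr0.
have -> : h i != i by apply: contraNneq hi_free => ->.
have -> : taken h i k = false.
  apply: contraNF i_neq => k_taken; apply/eqP.
  apply: (admissible_extra_seat adm _ _ _ i_taken k_taken).
  - by rewrite i0 ltnW.
  - by rewrite leqnn orbT.
  - by case/orP: k_out => [->//|/ltnW ->]; rewrite orbT.
by rewrite addn1 mulr0 add0r mulr1.
Qed.

Lemma admissible_taken_last (n : nat) (h : 'I_n -> 'I_n) (k : 'I_n) :
  admissible h -> taken h n k.
Proof.
move=> /admissible_inj h_inj; apply/existsP; exists (invF h_inj k).
by rewrite ltn_ord f_invF eqxx.
Qed.

Lemma admissible_misplaced (n : nat) (h : 'I_n -> 'I_n) : (0 < n)%N ->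
  admissible h ->
  #|[set i : 'I_n | h i != i]%SET| =
  (misplaced_before h n + (misplaced_before h n != 0))%N.
Proof.
case: n h => [//|n] h _ adm.
have -> : #|[set i : 'I_n.+1 | h i != i]%SET| =
    (misplaced_before h n.+1 + (h ord0 != ord0))%N.
  rewrite -sum1_card big_mkcond (bigD1 ord0) //= inE addnC.
  congr (_ + _)%N.
  rewrite /misplaced_before [LHS]big_mkcond [RHS]big_mkcond.
  apply: eq_bigr => j _.
  by rewrite inE ltn_ord andbT lt0n -val_eqE /=; do 2?case: eqP.
(* It remains that passenger 0 is at home exactly when all the others are. *)
congr (_ + nat_of_bool (~~ _))%N; apply/eqP/eqP => [h0|].
  rewrite /misplaced_before big1 // => j _; apply/eqP; rewrite eqb0 negbK.
  (* Strong induction: with all earlier passengers at home, seat [j] is free. *)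
  elim/ltn_ind: {j}(val j) {-2}j (erefl (val j)) => m IHm j jm.
  have [j0|j_gt0] := posnP j; first by rewrite (_ : j = ord0) ?h0 //; exact/val_inj.
  have [_ j_stay] := adm j j_gt0; apply/eqP/j_stay/existsPn => l.
  rewrite negb_and -implybE; apply/implyP => lj.
  by rewrite (eqP (IHm l _ l erefl)) -?jm // -val_eqE ltn_eqF.
(* The passenger whose seat passenger 0 took is misplaced, by injectivity. *)
move=> C0; apply/eqP/negPn/negP => h0; move/eqP: C0.
rewrite /misplaced_before (bigD1 (h ord0)) /=; last by rewrite ltn_ord andbT lt0n.
by rewrite (inj_eq (admissible_inj adm)) h0.
Qed.

(** * Random variables with values in a finite type *)

Lemma expectation_finite_valued (d : measure_display) (T : measurableType d)
    (R : realType) (P : probability T R) (F : finType) (X : T -> F) (g : F -> R) :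
  (forall x, measurable [set w | X w = x]) ->
  'E_P[fun w => g (X w)]%E = (\sum_x fine (P [set w | X w = x]) * g x)%:E.
Proof.
move=> mX; rewrite unlock.
have intX x : P.-integrable [set: T] (fun w => (\1_[set w | X w = x] w)%:E).
  exact: integrable_indic.
have gX w : (g (X w))%:E =
    (\sum_x (g x)%:E * (\1_[set w | X w = x] w)%:E)%E.
  rewrite (bigD1 (X w)) //= indicE mem_set // mule1 big1 ?adde0 // => x xXw.
  by rewrite indicE memNset ?mule0 //= => /eqP; rewrite eq_sym (negPf xXw).
under eq_integral do rewrite gX.
rewrite integral_sum //; last by move=> x; exact: integrableZl.
rewrite -sumEFin; apply: eq_bigr => x _.
rewrite integralZl // integral_indic // setIT muleC EFinM fineK //.
exact: fin_num_measure.
Qed.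

Lemma measurable_finite_valued (d : measure_display) (T : measurableType d)
    (F : finType) (X : T -> F) (A : pred F) :
  (forall x, measurable [set w | X w = x]) -> measurable [set w | A (X w)].
Proof.
move=> mX.
have -> : [set w | A (X w)] = \bigcup_(x in [set x | A x]) [set w | X w = x].
  by apply/seteqP; split=> [w Aw|w [x Ax /= ->]//]; exists (X w).
by apply: fin_bigcup_measurable.
Qed.

Lemma probability_finite_valued (d : measure_display) (T : measurableType d)
    (R : realType) (P : probability T R) (F : finType) (X : T -> F) (A : pred F) :
  (forall x, measurable [set w | X w = x]) ->
  fine (P [set w | A (X w)]) = \sum_(x | A x) fine (P [set w | X w = x]).
Proof.
move=> mX; have mA := measurable_finite_valued A mX.
rewrite -(expectation_indic P mA).
have -> : \1_[set w | A (X w)] = (fun w => (A (X w))%:R : R).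
  by apply/funext => w; rewrite indicE mem_setE.
rewrite (expectation_finite_valued P (fun x => (A x)%:R)) //= [RHS]big_mkcond /=.
by apply: eq_bigr => x _; case: (A x); rewrite ?mulr1 ?mulr0.
Qed.

(** A finite function, so that the whole seating is a single variable with values in a finite
    type. *)
Definition seating (T : Type) (n : nat) (S : 'I_n -> T -> 'I_n) (w : T) :
  {ffun 'I_n -> 'I_n} := [ffun i => S i w].

Lemma measurable_seating (d : measure_display) (T : measurableType d) (n : nat)
    (S : 'I_n -> T -> 'I_n) (h : {ffun 'I_n -> 'I_n}) :
  (forall i k : 'I_n, measurable [set w | S i w = k]) ->
  measurable [set w | seating S w = h].
Proof.
move=> mS.
have -> : [set w | seating S w = h] =
    \bigcap_(i in [set: 'I_n]) [set w | S i w = h i].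
  apply/seteqP; split=> [w /= <- i _ /=|w /= Sw]; first by rewrite ffunE.
  by apply/ffunP => i; rewrite ffunE; exact: Sw.
by apply: fin_bigcap_measurable.
Qed.

(** * The chain rule on the finite space of seatings *)

Definition agree (n i : nat) (h h' : 'I_n -> 'I_n) : bool :=
  [forall j : 'I_n, (j < i)%N ==> (h' j == h j)].

(** The second clause of [absent_minded_process] in terms of the weights [pr h] of complete
    seatings, which turns expectations into finite sums. *)
Definition chain_rule (R : realType) (n : nat)
    (pr : {ffun 'I_n -> 'I_n} -> R) : Prop :=
  forall (i k : 'I_n) (h : {ffun 'I_n -> 'I_n}),
    \sum_(h' : {ffun 'I_n -> 'I_n} | agree i h h' && (h' i == k)) pr h' =
    (\sum_(h' : {ffun 'I_n -> 'I_n} | agree i h h') pr h') * seat_prob R h i k.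

Lemma agreeP (n i : nat) (h h' : 'I_n -> 'I_n) :
  reflect (forall j : 'I_n, (j < i)%N -> h' j = h j) (agree i h h').
Proof.
apply: (iffP forallP) => [hh' j ji|hh' j]; first exact/eqP/(implyP (hh' j)).
by apply/implyP => /hh' ->.
Qed.

Lemma eq_empty_seats (n : nat) (h h' : 'I_n -> 'I_n) (i : 'I_n) :
  (forall j : 'I_n, (j < i)%N -> h' j = h j) ->
  empty_seats h' i = empty_seats h i.
Proof.
move=> hh'; apply/setP => k; rewrite !inE; apply: eq_forallb => j.
by case: (ltnP j i) => // /hh' ->.
Qed.

Lemma eq_seat_prob (R : realType) (n : nat) (h h' : 'I_n -> 'I_n) (i k : 'I_n) :
  (forall j : 'I_n, (j < i)%N -> h' j = h j) ->
  seat_prob R h' i k = seat_prob R h i k.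
Proof. by move=> hh'; rewrite /seat_prob (eq_empty_seats hh'). Qed.

Lemma process_chain_rule (d : measure_display) (T : measurableType d)
    (R : realType) (P : probability T R) (n : nat) (S : 'I_n -> T -> 'I_n) :
  absent_minded_process P S ->
  chain_rule (fun h => fine (P [set w | seating S w = h])).
Proof.
move=> [mS PS] i k h.
(* The process reads the seat of [i] off the same function as the past, so [k] is spliced into [h]
   at [i]. *)
pose h1 : 'I_n -> 'I_n := fun j => if j == i then k else h j.
have h1_lt (j : 'I_n) : (j < i)%N -> h1 j = h j.
  by move=> ji; rewrite /h1 -val_eqE ltn_eqF.
have h1i : h1 i = k by rewrite /h1 eqxx.
have mX x := measurable_seating x mS.
rewrite -!(probability_finite_valued P _ mX).
have -> : [set w | agree i h (seating S w) && (seating S w i == k)] =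
    [set w | forall j : 'I_n, (j <= i)%N -> S j w = h1 j].
  apply/seteqP; split=> w /=.
    move=> /andP[/agreeP hw /eqP iw] j; rewrite leq_eqVlt.
    case/orP => [/eqP/val_inj ->|ji]; first by rewrite h1i -iw ffunE.
    by rewrite h1_lt // -hw // ffunE.
  move=> hw; apply/andP; split; last by rewrite ffunE hw // h1i.
  by apply/agreeP => j ji; rewrite ffunE hw ?h1_lt // ltnW.
have mh := measurable_finite_valued
  (fun h' : {ffun 'I_n -> 'I_n} => agree i h h') mX.
have -> : fine (P [set w | agree i h (seating S w)]) * seat_prob R h i k =
    fine (P [set w | agree i h (seating S w)] * (seat_prob R h i k)%:E)%E.
  by rewrite fineM //; exact: fin_num_measure.
have -> : [set w | agree i h (seating S w)] =
    [set w | forall j : 'I_n, (j < i)%N -> S j w = h1 j].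
  apply/seteqP; split=> w /=.
    by move=> /agreeP hw j ji; rewrite h1_lt // -hw // ffunE.
  by move=> hw; apply/agreeP => j ji; rewrite ffunE hw ?h1_lt.
by rewrite PS (eq_seat_prob _ _ h1_lt) h1i.
Qed.

(** Conditioning on the past of [i]: [g] depends only on that past and factors out, and the
    indicator averages to its conditional probability. *)
Lemma chain_rule_step (R : realType) (n : nat)
    (pr : {ffun 'I_n -> 'I_n} -> R) (g : {ffun 'I_n -> 'I_n} -> R) (i k : 'I_n) :
  (forall h h' : {ffun 'I_n -> 'I_n}, agree i h h' -> g h' = g h) ->
  chain_rule pr ->
  \sum_h pr h * (g h * (h i == k)%:R) = \sum_h pr h * (g h * seat_prob R h i k).
Proof.
move=> g_agree chain.
(* [cut h] is a canonical representative of the seatings with the same past as [h]; a [c] not fixed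
   by [cut] has an empty fibre. *)
pose cut (h : {ffun 'I_n -> 'I_n}) : {ffun 'I_n -> 'I_n} :=
  [ffun j : 'I_n => if (j < i)%N then h j else i].
rewrite [LHS](partition_big cut predT) //= [RHS](partition_big cut predT) //=.
apply: eq_bigr => c _.
have [cutc|cutNc] := eqVneq (cut c) c; last first.
  have cut_neq h : (cut h == c) = false.
    apply: contraNF cutNc => /eqP <-; apply/eqP/ffunP => j; rewrite !ffunE.
    by case: (j < i)%N.
  by rewrite !big_pred0.
have cutE h : (cut h == c) = agree i c h.
  apply/eqP/agreeP => [<- j ji|hc]; first by rewrite ffunE ji.
  by rewrite -cutc; apply/ffunP => j; rewrite !ffunE; case: ifP => // /hc.
rewrite !(eq_bigl _ _ cutE).
transitivity (g c *
    \sum_(h : {ffun 'I_n -> 'I_n} | agree i c h && (h i == k)) pr h).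
  rewrite big_mkcondr big_distrr /=; apply: eq_bigr => h ch.
  rewrite (g_agree _ _ ch); case: (h i == k); rewrite ?mulr0 //.
  by rewrite mulr1 mulrC.
rewrite chain mulrCA big_distrl /=; apply: eq_bigr => h ch.
by rewrite (g_agree _ _ ch) (eq_seat_prob _ _ (agreeP _ _ _ ch)).
Qed.

(** If some [seat_prob] along [h] vanished, a sum of nonnegative weights containing [pr h] would be
    zero. *)
Lemma chain_rule_admissible (R : realType) (n : nat)
    (pr : {ffun 'I_n -> 'I_n} -> R) (h : {ffun 'I_n -> 'I_n}) :
  (forall h, 0 <= pr h) -> chain_rule pr -> pr h != 0 -> admissible h.
Proof.
move=> pr_ge0 chain prh; apply: (@seat_prob_admissible R) => i.
apply: contraNneq prh => q0; have := chain i (h i) h; rewrite q0 mulr0.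
move=> /eqP; rewrite psumr_eq0 // => /allP /(_ h (mem_index_enum h)).
by rewrite /= eqxx andbT => /implyP -> //; apply/agreeP.
Qed.

(** * Joint law of the misplaced count and the extra seat *)

Definition taken_mean (R : realType) (n : nat) (pr : {ffun 'I_n -> 'I_n} -> R)
    (g : nat -> R) (i : nat) (k : 'I_n) : R :=
  \sum_h pr h * (g (misplaced_before h i) * (taken h i k)%:R).

Lemma taken_mean1 (R : realType) (n : nat) (pr : {ffun 'I_n -> 'I_n} -> R)
    (g : nat -> R) (k : 'I_n) :
  \sum_h pr h = 1 -> chain_rule pr -> taken_mean pr g 1 k = g 0 / n%:R.
Proof.
move=> pr1 chain.
pose i0 := Ordinal (leq_ltn_trans (leq0n k) (ltn_ord k)).
transitivity (\sum_h pr h * (g 0 * (h i0 == k)%:R)).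
  apply: eq_bigr => h _; congr (_ * (g _ * _)).
    by rewrite /misplaced_before big1 // => j; case: (val j).
  rewrite (taken_S h i0) (_ : taken h i0 k = false) //.
  by apply/existsP => -[j].
rewrite (chain_rule_step _ _ chain) //.
under eq_bigr do rewrite /seat_prob /=.
by rewrite -big_distrl /= pr1 mul1r.
Qed.

(** This is [admissible_step] averaged: when seat [i] is taken, passenger [i] chooses [k] with
    conditional probability 1/(n - i). *)
Lemma taken_meanS (R : realType) (n : nat) (pr : {ffun 'I_n -> 'I_n} -> R)
    (g : nat -> R) (i k : 'I_n) :
  (forall h, 0 <= pr h) -> chain_rule pr ->
  (0 < i)%N -> (k == 0 :> nat) || (i < k)%N ->
  taken_mean pr g i.+1 k =
  taken_mean pr g i k + (n - i)%:R^-1 * taken_mean pr (g \o succn) i i.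
Proof.
move=> pr_ge0 chain i0 k_out.
transitivity (taken_mean pr g i k + \sum_h pr h *
    (g (misplaced_before h i).+1 * (taken h i i)%:R * (h i == k)%:R)).
  rewrite -big_split /=; apply: eq_bigr => h _; rewrite -mulrDr.
  have [->|prh] := eqVneq (pr h) 0; first by rewrite !mul0r.
  congr (_ * _); apply: admissible_step => //.
  exact: chain_rule_admissible prh.
congr (_ + _); rewrite (chain_rule_step _ _ chain) /=; last first.
  move=> h h' /agreeP hh'; congr (g _.+1 * (nat_of_bool _)%:R).
    by apply: eq_bigr => j /andP[_ ji]; rewrite hh'.
  by apply: eq_existsb => j; case: ltnP => //= ji; rewrite hh'.
rewrite big_distrr /=; apply: eq_bigr => h _.
have [->|prh] := eqVneq (pr h) 0; first by rewrite !mul0r mulr0.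
have adm := chain_rule_admissible pr_ge0 chain prh.
rewrite [RHS]mulrCA; congr (_ * _); rewrite [RHS]mulrC.
have [i_taken|i_free] := boolP (taken h i i); last by rewrite !mulr0 !mul0r.
congr (_ * _); rewrite /seat_prob gtn_eqF // !in_empty_seats i_taken /=.
rewrite card_empty_seats // ifT //.
have k_out' : (k == 0 :> nat) || (i <= k)%N.
  by case/orP: k_out => [->//|/ltnW ->]; rewrite orbT.
(* Seat [k] is still empty, for otherwise [i] and [k] would be two extra seats. *)
apply: contraL k_out => k_taken.
have <- : i = k.
  apply: (admissible_extra_seat adm _ _ _ i_taken k_taken).
  - by rewrite i0 ltnW.
  - by rewrite leqnn orbT.
  - exact: k_out'.
by rewrite ltnn orbF -lt0n.
Qed.

(** The increment in [taken_meanS] is the same for every [k], and so is the initial value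
    [g 0 / n%:R]. *)
Lemma taken_mean_uniform (R : realType) (n : nat)
    (pr : {ffun 'I_n -> 'I_n} -> R) (g : nat -> R) (i : nat) (k l : 'I_n) :
  (forall h, 0 <= pr h) -> \sum_h pr h = 1 -> chain_rule pr ->
  (0 < i <= n)%N ->
  (k == 0 :> nat) || (i <= k)%N -> (l == 0 :> nat) || (i <= l)%N ->
  taken_mean pr g i k = taken_mean pr g i l.
Proof.
move=> pr_ge0 pr1 chain; case: i => [//|i]; elim: i k l => [|i IHi] k l /=.
  by rewrite !taken_mean1.
move=> i_n k_out l_out; rewrite !(taken_meanS _ (i := Ordinal i_n)) //=.
congr (_ + _); apply: IHi; first exact: ltnW.
  by case/orP: k_out => [->//|/ltnW ->]; rewrite orbT.
by case/orP: l_out => [->//|/ltnW ->]; rewrite orbT.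
Qed.

(** The extra seat is one of n - i + 1 equally likely seats, so the left side is the mean of
    [bernoulli_mean (n - i).+1 f] at the current count. This is a martingale: the passengers still
    to board contribute the B_j with 2 <= j <= n - i + 1, and B_1 = 1 adds one. *)
Lemma taken_mean_bernoulli (R : realType) (n : nat)
    (pr : {ffun 'I_n -> 'I_n} -> R) (f : nat -> R) (i : nat) (k : 'I_n) :
  (forall h, 0 <= pr h) -> \sum_h pr h = 1 -> chain_rule pr ->
  (0 < i <= n)%N -> (k == 0 :> nat) || (i <= k)%N ->
  (n - i).+1%:R * taken_mean pr (bernoulli_mean (n - i).+1 f) i k =
  bernoulli_mean n f 0.
Proof.
move=> pr_ge0 pr1 chain; case: i => [//|i]; elim: i k => [|i IHi] k /=.
  move=> n0 _; rewrite subn1 prednK // taken_mean1 // mulrC divfK //.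
  by rewrite pnatr_eq0 -lt0n.
move=> i_n k_out; have i_n' := ltnW i_n.
have k_out' : (k == 0 :> nat) || (i.+1 <= k)%N.
  by case/orP: k_out => [->//|/ltnW ->]; rewrite orbT.
rewrite -(IHi k) // (taken_meanS _ (i := Ordinal i_n)) //= subnSK //.
set m := (n - i.+1)%N; have m0 : m%:R != 0 :> R.
  by rewrite pnatr_eq0 subn_eq0 -ltnNge.
(* Uniformity moves the increment from seat [i.+1] to [k], so that both sides involve the same two
   means. *)
rewrite (@taken_mean_uniform _ _ _ _ i.+1 (Ordinal i_n) k) //=.
have -> : taken_mean pr (bernoulli_mean m.+1 f) i.+1 k =
    (1 - m.+1%:R^-1) * taken_mean pr (bernoulli_mean m f) i.+1 k +
    m.+1%:R^-1 * taken_mean pr (bernoulli_mean m f \o succn) i.+1 k.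
  rewrite /taken_mean !big_distrr /= -big_split /=; apply: eq_bigr => h _.
  by rewrite bernoulli_meanS /bernoulli_step; ring.
have m1 : m%:R + 1 != 0 :> R by rewrite natr1 pnatr_eq0.
by rewrite -natr1; field; rewrite m0 m1.
Qed.

(** * Law and moments of the number of misplaced passengers *)

Lemma mean_misplaced (R : realType) (n : nat)
    (pr : {ffun 'I_n -> 'I_n} -> R) (phi : nat -> R) :
  (forall h, 0 <= pr h) -> \sum_h pr h = 1 -> chain_rule pr -> (0 < n)%N ->
  \sum_h pr h * phi #|[set i : 'I_n | h i != i]%SET| =
  bernoulli_mean n phi 0 - (phi 1 - phi 0) / n%:R.
Proof.
move=> pr_ge0 pr1 chain n0; pose k := Ordinal n0.
(* At time [n] seat 0 is the only candidate left, and B_1 = 1 shifts the count by one. *)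
have mean f : \sum_h pr h * f (misplaced_before h n).+1 = bernoulli_mean n f 0.
  rewrite -(@taken_mean_bernoulli _ _ pr f n k) ?n0 ?leqnn //.
  rewrite subnn mul1r; apply: eq_bigr => h _.
  have [->|prh] := eqVneq (pr h) 0; first by rewrite !mul0r.
  rewrite admissible_taken_last; last exact: chain_rule_admissible prh.
  by rewrite bernoulli_meanS /bernoulli_step invr1 subrr mul0r add0r mul1r mulr1.
(* This test function gives probability 1/n to the event that nobody is misplaced. *)
have := mean (fun c => (c == 1)%:R).
rewrite bernoulli_mean_atom1 // mul1r => mean0.
rewrite mulrC -mean -mean0 big_distrl /= -sumrB; apply: eq_bigr => h _.
have [->|prh] := eqVneq (pr h) 0; first by rewrite !mul0r subr0.
rewrite admissible_misplaced //; last exact: chain_rule_admissible prh.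
case: (misplaced_before h n) => [|c]; first by rewrite addn0 /=; ring.
by rewrite addn1 /=; ring.
Qed.

Lemma expectation_misplaced (d : measure_display) (T : measurableType d)
    (R : realType) (P : probability T R) (n : nat) (S : 'I_n -> T -> 'I_n)
    (phi : nat -> R) :
  (0 < n)%N -> absent_minded_process P S ->
  'E_P[fun w => phi #|[set i : 'I_n | S i w != i]%SET|]%E =
  (bernoulli_mean n phi 0 - (phi 1 - phi 0) / n%:R)%:E.
Proof.
move=> n0 procS; have mX h := measurable_seating h procS.1.
rewrite -(mean_misplaced phi _ _ (process_chain_rule procS) n0); first last.
- rewrite -(probability_finite_valued P predT mX) (_ : [set w | _] = setT).
    by rewrite probability_setT.
  by apply/seteqP; split.
- by move=> h; exact: fine_ge0.
rewrite -(expectation_finite_valued P _ mX); congr expectation.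
apply/funext => w; congr (phi #|pred_of_set _|).
by apply/setP => i; rewrite !inE ffunE.
Qed.

Lemma expectation_misplaced_pow (d : measure_display) (T : measurableType d)
    (R : realType) (P : probability T R) (n : nat) (S : 'I_n -> T -> 'I_n)
    (a : R) (s : nat) :
  (0 < n)%N -> absent_minded_process P S -> (s <= 6)%N ->
  let H := harmonic_sum R n in
  let M x := moment_of_cumulants x (bernoulli_cumulant H) s in
  'E_P[(fun w => (misplaced R S w - a) ^+ s)%R]%E =
  ((1 - n%:R^-1) * M (H 1 - a) + n%:R^-1 * M (1 + H 1 - a)
   - ((1 - a) ^+ s - (- a) ^+ s) / n%:R)%:E.
Proof.
move=> n0 procS s6 H M.
rewrite (expectation_misplaced (fun c => (c%:R - a) ^+ s) n0 procS).
(* B_n is split off because [harmonic_sum R n] stops at n - 1: the cumulants are those of B_1 + ...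
   + B_(n-1). *)
rewrite -[in bernoulli_mean n _](prednK n0) bernoulli_meanS /bernoulli_step.
by rewrite !bernoulli_mean_moment // prednK // add0r sub0r.
Qed.

Theorem theorem5 (R : realType) (d : measure_display) (T : measurableType d)
    (P : probability T R) (n : nat) (S : 'I_n -> T -> 'I_n)
    (hn : (2 <= n)%N) (hS : absent_minded_process P S) :
  let X : T -> R := misplaced R S in
  let N : R := n%:R in
  let H1 : R := harmonic_sum R n 1 in
  let H2 : R := harmonic_sum R n 2 in
  let H3 : R := harmonic_sum R n 3 in
  let H4 : R := harmonic_sum R n 4 in
  let H5 : R := harmonic_sum R n 5 in
  let H6 : R := harmonic_sum R n 6 in
  'E_P[X]%E = H1%:E /\
  'V_P[X]%E = ((N * H1 - N * H2 + 2 * H1) / N)%:E /\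
  central_moment P X 3 =
    ((N * H1 - 3 * N * H2 + 2 * N * H3 - 3 * H1 ^+ 2 + 6 * H1 - 3 * H2)
     / N)%:E /\
  central_moment P X 4 =
    ((3 * N * H1 ^+ 2 - 6 * N * H1 * H2 + 3 * N * H2 ^+ 2 + 4 * H1 ^+ 3
      + N * H1 - 7 * N * H2 + 12 * N * H3 - 6 * N * H4 - 6 * H1 ^+ 2
      + 14 * H1 - 18 * H2 + 8 * H3) / N)%:E /\
  central_moment P X 5 =
    (1 / N *
     (- 5 * H1 ^+ 4 + 10 * N * H1 ^+ 2 - 40 * N * H1 * H2 + 20 * N * H1 * H3
      + 30 * N * H2 ^+ 2 - 20 * N * H2 * H3 + 10 * H1 ^+ 3 + N * H1
      - 15 * N * H2 + 50 * N * H3 - 60 * N * H4 + 24 * N * H5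
      + 5 * H1 ^+ 2 - 30 * H1 * H2 + 15 * H2 ^+ 2 + 30 * H1 - 75 * H2
      + 80 * H3 - 30 * H4))%:E /\
  central_moment P X 6 =
    (1 / N *
     (6 * H1 ^+ 5 + 15 * N * H1 ^+ 3 - 45 * N * H1 ^+ 2 * H2
      + 45 * N * H1 * H2 ^+ 2 - 15 * N * H2 ^+ 3 - 15 * H1 ^+ 4
      + 25 * N * H1 ^+ 2 - 180 * N * H1 * H2 + 220 * N * H1 * H3
      - 90 * N * H1 * H4 + 195 * N * H2 ^+ 2 - 300 * N * H2 * H3
      + 90 * N * H2 * H4 + 40 * N * H3 ^+ 2 + 20 * H1 ^+ 3 + N * H1
      - 31 * N * H2 + 180 * N * H3 - 390 * N * H4 + 360 * N * H5
      - 120 * N * H6 + 90 * H1 ^+ 2 - 330 * H1 * H2 + 120 * H1 * H3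
      + 225 * H2 ^+ 2 - 120 * H2 * H3 + 62 * H1 - 270 * H2 + 520 * H3
      - 450 * H4 + 144 * H5))%:E.
Proof.
move=> X N H1 H2 H3 H4 H5 H6; have n0 : (0 < n)%N by exact: ltnW.
have N0 : N != 0 by rewrite pnatr_eq0 -lt0n.
have EX : 'E_P[X]%E = H1%:E.
  have := expectation_misplaced_pow 0 n0 hS (isT : (1 <= 6)%N).
  rewrite (_ : (fun w => (misplaced R S w - 0) ^+ 1) = X); last first.
    by apply/funext => w; rewrite subr0 expr1.
  by move=> ->; congr EFin; rewrite /= -/N -/H1; field.
(* Centring at [H1] makes the mean 0 or 1 according to the value of B_n. *)
have moment s : (s <= 6)%N -> central_moment P X s =
    ((1 - N^-1) * moment_of_cumulants 0 (bernoulli_cumulant (harmonic_sum R n)) s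
     + N^-1 * moment_of_cumulants 1 (bernoulli_cumulant (harmonic_sum R n)) s
     - ((1 - H1) ^+ s - (- H1) ^+ s) / N)%:E.
  move=> s6.
  rewrite /central_moment EX /= (expectation_misplaced_pow H1 n0 hS s6).
  by rewrite -/H1 subrr addrK.
split=> //; split.
  have -> : 'V_P[X]%E = central_moment P X 2.
    by rewrite /variance unlock; congr expectation; apply/funext => w.
  by rewrite moment //; congr EFin; rewrite /= -/H1 -/H2; field; exact: N0.
split.
  by rewrite moment //; congr EFin; rewrite /= -/H1 -/H2 -/H3; field; exact: N0.
split.
  by rewrite moment //; congr EFin; rewrite /= -/H1 -/H2 -/H3 -/H4; field; exact: N0.
split.
  by rewrite moment //; congr EFin; rewrite /= -/H1 -/H2 -/H3 -/H4 -/H5;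
    field; exact: N0.
by rewrite moment //; congr EFin; rewrite /= -/H1 -/H2 -/H3 -/H4 -/H5 -/H6;
  field; exact: N0.
Qed.
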